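(* Let $(X,\langle\cdot,\cdot\rangle)$ be a real Hilbert space with norm $\|x\|=\sqrt{\langle x,x\rangle}$. Then for all $x,y,z\in X$, $$|\langle x,z\rangle\langle z,y\rangle|\le \sqrt{\|z\|^2\|x\|^2-\langle x,z\rangle^2}\;\sqrt{\|z\|^2\|y\|^2-\langle y,z\rangle^2}+\|z\|^2\,|\langle x,y\rangle|.$$ *)

(* Defs.v *)
From HB Require Import structures.
From mathcomp Require Import all_boot all_order all_algebra.
From mathcomp Require Import all_classical all_reals all_analysis.

Set Implicit Arguments.
Unset Strict Implicit.
Unset Printing Implicit Defensive.

Import Order.TTheory GRing.Theory Num.Theory.
Import numFieldNormedType.Exports.

Local Open Scope ring_scope.

(* A real Hilbert space is a complete normed space [X] over [R] together with
   a symmetric positive definite bilinear form [dot] (a [{dot X for idfun}])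
   that induces the norm of [X]. Completeness is part of
   [completeNormedModType], so it refers to this same norm. *)
Definition induces_norm (R : realType) (X : completeNormedModType R)
    (dot : {dot X for idfun}) : Prop :=
  forall x : X, `|x| = Num.sqrt (dot x x).

(* Main.v *)
Require Import Defs.
From HB Require Import structures.
From mathcomp Require Import all_boot all_order all_algebra.
From mathcomp Require Import all_classical all_reals all_analysis.
From mathcomp Require Import ring.

Set Implicit Arguments.
Unset Strict Implicit.
Unset Printing Implicit Defensive.

Import Order.TTheory GRing.Theory Num.Theory.
Import numFieldNormedType.Exports.

Local Open Scope ring_scope.

(** For fixed [z], the Gram form [G(u, v) = <z,z><u,v> - <u,z><z,v>], which is
    [<z,z>] times the inner product of the projections of [u] and [v] onto the
    orthogonal complement of [z], is again bilinear and symmetric. The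
    Cauchy-Schwarz inequality for [<.,.>] says exactly that [G(u, u) >= 0].
    Applying Cauchy-Schwarz once more, now to [G], bounds [|G(x, y)|] by
    [sqrt G(x, x) * sqrt G(y, y)], and the claim is the triangle inequality for
    [<x,z><z,y> = <z,z><x,y> - G(x, y)]. Since [G(z, z) = 0], the form [G]
    is not definite, so Cauchy-Schwarz is proved for semidefinite forms. *)

Section Symmetric.
Variables (R : comNzRingType) (U : lmodType R) (f : {symmetric U}).

Lemma symmetric_formC u v : f u v = f v u.
Proof. by rewrite hermitian_subproof expr0 mul1r. Qed.

Lemma symmetric_form_lincomb a b u v :
  f (a *: u + b *: v) (a *: u + b *: v) =
  a ^+ 2 * f u u + 2 * a * b * f u v + b ^+ 2 * f v v.
Proof.
rewrite linearDl !linearDr !linearZl_LR !linearZr_LR /= (symmetric_formC v u).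
by ring.
Qed.

End Symmetric.

Section PositiveSemidefinite.
Variables (R : realFieldType) (U : lmodType R) (f : {symmetric U}).
Hypothesis f_ge0 : forall u, 0 <= f u u.

(** On the line [u + t v], with [v] isotropic, the form is an affine function of
    [t], and a nonconstant affine function takes negative values. *)
Lemma psd_form_isotropic u v : f v v = 0 -> f u v = 0.
Proof.
move=> fv0; apply/eqP/negPn/negP => fuv0.
(* This coefficient of [v] makes the form take the value [-1]. *)
have := f_ge0 (1 *: u + (- (f u u + 1) / (2 * f u v)) *: v).
rewrite symmetric_form_lincomb fv0 leNgt => /negP; apply.
suff -> : 1 ^+ 2 * f u u + 2 * 1 * (- (f u u + 1) / (2 * f u v)) * f u v +
  (- (f u u + 1) / (2 * f u v)) ^+ 2 * 0 = -1 by rewrite ltrN10.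
by field.
Qed.

(** If [v] is not isotropic, the vector [f(v,v) u - f(u,v) v], orthogonal to
    [v], has square [f(v,v) * (f(u,u) f(v,v) - f(u,v)^2)]. *)
Lemma psd_form_CauchySchwarz u v : f u v ^+ 2 <= f u u * f v v.
Proof.
have [fv0|fvN0] := eqVneq (f v v) 0.
  by rewrite (psd_form_isotropic u fv0) fv0 expr0n mulr0.
have fv_gt0 : 0 < f v v by rewrite lt_def fvN0 f_ge0.
have := f_ge0 (f v v *: u + (- f u v) *: v).
rewrite symmetric_form_lincomb.
have -> : f v v ^+ 2 * f u u + 2 * f v v * - f u v * f u v +
    (- f u v) ^+ 2 * f v v = f v v * (f u u * f v v - f u v ^+ 2) by ring.
by rewrite pmulr_rge0 // subr_ge0.
Qed.

End PositiveSemidefinite.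

Lemma psd_form_CauchySchwarz_sqrt (R : rcfType) (U : lmodType R)
    (f : {symmetric U}) (f_ge0 : forall u, 0 <= f u u) u v :
  `|f u v| <= Num.sqrt (f u u) * Num.sqrt (f v v).
Proof.
by rewrite -sqrtrM // -sqrtr_sqr ler_wsqrtr ?psd_form_CauchySchwarz.
Qed.

Section GramForm.
Variables (R : comNzRingType) (U : lmodType R) (f : {symmetric U}) (z : U).

(** The Gram determinant of [(u, z)] against [(v, z)]. *)
Definition gram_form (u v : U) : R := f z z * f u v - f u z * f z v.

Let gram_form_bilinear : bilinear_for
  (GRing.Scale.Law.clone _ _ *%R _) (GRing.Scale.Law.clone _ _ (idfun \; *%R) _)
  gram_form.
Proof.
split=> [w|w] a u v; rewrite /gram_form /=.
  by rewrite !linearDl !linearZl_LR /=; ring.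
by rewrite !linearDr !linearZr_LR /=; ring.
Qed.

HB.instance Definition _ :=
  bilinear_isBilinear.Build R U U R _ _ gram_form gram_form_bilinear.

Let gram_form_hermitian u v :
  gram_form u v = (-1) ^+ false * idfun (gram_form v u).
Proof.
rewrite expr0 mul1r /= /gram_form (symmetric_formC f u v).
by rewrite (symmetric_formC f u z) (symmetric_formC f z v); ring.
Qed.

HB.instance Definition _ :=
  isHermitianSesquilinear.Build R U false idfun gram_form gram_form_hermitian.

End GramForm.

Lemma gram_form_ge0 (R : realFieldType) (U : lmodType R) (f : {symmetric U})
    (f_ge0 : forall u, 0 <= f u u) z u : 0 <= gram_form f z u u.
Proof.
rewrite /gram_form subr_ge0 (symmetric_formC f z u) -expr2 mulrC.
exact: psd_form_CauchySchwarz.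
Qed.

Theorem corollary2p3 (R : realType) (X : completeNormedModType R)
    (dot : {dot X for idfun}) (dot_norm : induces_norm dot) (x y z : X) :
  `|dot x z * dot z y| <=
    Num.sqrt (`|z| ^+ 2 * `|x| ^+ 2 - dot x z ^+ 2) *
    Num.sqrt (`|z| ^+ 2 * `|y| ^+ 2 - dot y z ^+ 2) +
    `|z| ^+ 2 * `|dot x y|.
Proof.
have dot_ge0 u : 0 <= dot u u.
  have [->|u0] := eqVneq u 0; first by rewrite linear0r.
  exact/ltW/neq0_dnorm_gt0.
have normE u : `|u| ^+ 2 = dot u u by rewrite dot_norm sqr_sqrtr.
have gramE u : `|z| ^+ 2 * `|u| ^+ 2 - dot u z ^+ 2 = gram_form dot z u u.
  by rewrite /gram_form !normE (symmetric_formC dot z u) expr2.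
rewrite !gramE normE.
have -> : dot x z * dot z y = dot z z * dot x y - gram_form dot z x y.
  by rewrite /gram_form subKr.
apply: le_trans (ler_normB _ _) _.
rewrite normrM (ger0_norm (dot_ge0 z)) addrC lerD2r.
exact/psd_form_CauchySchwarz_sqrt/gram_form_ge0.
Qed.
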